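(* Let $f\in\mathbb{R}[x_1,\ldots,x_n]$ be a homogeneous polynomial of degree $d\ge 3$, and let $\mathscr{C}$ be an open, convex and effective cone in $\mathbb{R}^n$, with lineality space $L_{\mathscr{C}}$. Suppose that (1) $f(\mathbf{x}+\mathbf{w})=f(\mathbf{x})$ for all $\mathbf{x}\in\mathbb{R}^n$ and $\mathbf{w}\in L_{\mathscr{C}}$; (2) $D_{\mathbf{v}_1}\cdots D_{\mathbf{v}_d}f>0$ for all $\mathbf{v}_1,\ldots,\mathbf{v}_d\in\mathscr{C}$; (3) for all $\mathbf{v}_1,\ldots,\mathbf{v}_{d-2}\in\mathscr{C}$, the Hessian of the quadratic polynomial $D_{\mathbf{v}_1}\cdots D_{\mathbf{v}_{d-2}}f$ is irreducible and its off-diagonal entries are nonnegative; (4) $\partial_i f$ is $\mathscr{C}$-Lorentzian for every $i\in\{1,\ldots,n\}$. Then $f$ is $\mathscr{C}$-Lorentzian.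
   Context: Notation: $\partial_i=\partial/\partial x_i$, and for $\mathbf{u}=(u_1,\ldots,u_n)\in\mathbb{R}^n$, $D_{\mathbf{u}}=u_1\partial_1+\cdots+u_n\partial_n$. The Hessian of $g$ at $\mathbf{x}$ is the matrix $(\partial_i\partial_j g(\mathbf{x}))_{i,j=1}^n$; for a quadratic polynomial it is a constant matrix. $\mathscr{C}$-Lorentzian: let $\mathscr{C}$ be an open convex cone in $\mathbb{R}^n$. A homogeneous polynomial $g\in\mathbb{R}[x_1,\ldots,x_n]$ of degree $d$ is $\mathscr{C}$-Lorentzian if for all $\mathbf{v}_1,\ldots,\mathbf{v}_d\in\mathscr{C}$: (P) $D_{\mathbf{v}_1}\cdots D_{\mathbf{v}_d}g>0$, and (H) the symmetric bilinear form $(\mathbf{x},\mathbf{y})\mapsto D_{\mathbf{x}}D_{\mathbf{y}}D_{\mathbf{v}_3}\cdots D_{\mathbf{v}_d}g$ has exactly one positive eigenvalue, counted with multiplicity (condition (H) is vacuous if $d\le 1$). By convention the identically zero polynomial is also $\mathscr{C}$-Lorentzian. Irreducible: a matrix $A=(a_{ij})_{i,j=1}^n$ with nonnegative off-diagonal entries is irreducible if for all distinct $i,j$ there is a sequence $i=i_0,i_1,\ldots,i_\ell=j$ with $i_{k-1}\ne i_k$ for all $1\le k\le\ell$ and $a_{i_0i_1}a_{i_1i_2}\cdots a_{i_{\ell-1}i_\ell}>0$. Lineality space: $L_{\mathscr{C}}=\overline{\mathscr{C}}\cap(-\overline{\mathscr{C}})$. Effective: $\mathscr{C}$ is effective if $\mathscr{C}=(\mathscr{C}\cap\mathbb{R}_{>0}^n)+L_{\mathscr{C}}$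 (Minkowski sum). *)

(* Defs.v *)
From HB Require Import structures.
(* mpoly has to be imported before the topology files: in the other order the
   notations of the two libraries clash. *)
From mathcomp Require Import all_boot all_order all_algebra.
From mathcomp Require Import mpoly.
From mathcomp Require Import classical_sets reals topology normedtype convex.
Set Implicit Arguments.
Unset Strict Implicit.
Unset Printing Implicit Defensive.
Import Order.TTheory GRing.Theory Num.Theory.
Import numFieldNormedType.Exports.
Local Open Scope classical_set_scope.
Local Open Scope ring_scope.

Section Polynomials.
Variables (R : realType) (n : nat).
Implicit Types (g : {mpoly R[n]}) (u v x y : 'rV[R]_n) (C : set 'rV[R]_n).

Definition dirderiv u g : {mpoly R[n]} := \sum_(i < n) u 0 i *: g^`M(i).

Definition dirderivs (vs : seq 'rV[R]_n) g : {mpoly R[n]} :=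
  foldr dirderiv g vs.

Definition hessian g x : 'M[R]_n :=
  \matrix_(i, j) (g^`M(j)^`M(i)).@[x 0].

(* For symmetric A, where algebraic and geometric multiplicities agree. *)
Definition one_positive_eigenvalue (A : 'M[R]_n) : Prop :=
  exists a : R,
    [/\ 0 < a, eigenvalue A a, mup a (char_poly A) = 1%N
      & forall b : R, 0 < b -> eigenvalue A b -> b = a].

(* The degree d of a nonzero homogeneous polynomial is determined by it.
   A derivative of order d of a form of degree d is a constant polynomial,
   identified here with its constant coefficient _@_0. *)
Definition lorentzian C g : Prop :=
  g = 0 \/
  exists d : nat,
    g \is d.-homog /\
    forall vs : d.-tuple 'rV[R]_n, (forall v, v \in vs -> C v) ->
      0 < (dirderivs vs g)@_0%MM /\
      ((2 <= d)%N ->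
       one_positive_eigenvalue
         (matrix_of_form (fun x y =>
            (dirderiv x (dirderiv y (dirderivs (drop 2 vs) g)))@_0%MM))).

End Polynomials.

Section Matrices.
Variables (R : realType) (n : nat).

Definition offdiag_nonneg (A : 'M[R]_n) : Prop :=
  forall i j : 'I_n, i != j -> 0 <= A i j.

(* The sequence i_0, ..., i_l is i :: s; the pairmap lists the entries
   A i_0 i_1, ..., A i_(l-1) i_l. *)
Definition irreducible_mx (A : 'M[R]_n) : Prop :=
  forall i j : 'I_n, i != j ->
    exists s : seq 'I_n,
      [/\ path (fun k l => k != l) i s, last i s = j
        & 0 < \prod_(a <- pairmap A i s) a].

End Matrices.

Section Cones.
Variables (R : realType) (n : nat).
Implicit Types C : set 'rV[R]_n.

Definition open_convex_cone C : Prop :=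
  [/\ open C, convex_set (C : set (convex_lmodType 'rV[R]_n))
    & forall (t : R) (x : 'rV[R]_n), 0 < t -> C x -> C (t *: x)].

Definition lineality_space C : set 'rV[R]_n :=
  [set w | closure C w /\ closure C (- w)].

Definition positive_orthant : set 'rV[R]_n :=
  [set x | forall i : 'I_n, 0 < x 0 i].

Definition effective C : Prop :=
  C = [set x + w | x in C `&` positive_orthant & w in lineality_space C].

End Cones.

(* Main.v *)
(* Fix v_3, ..., v_d in C. By effectiveness v_3 = p + w with p in C positive and
   w in the lineality space, and D_w f = 0, so the form to study is the Hessian
   A = sum_i p_i A_i of D_p G, where G = D_{v_4} ... D_{v_d} f and A_i is the
   Hessian of the i-th partial derivative of G. Each A_i has one positive
   eigenvalue, (Ap)_i = A_i(p, p) > 0 and (Ax)_i = A_i(x, p), so the reversed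
   Cauchy-Schwarz inequality A_i(x, x) A_i(p, p) <= A_i(x, p)^2 yields
   A(x, x) <= sum_i p_i (Ax)_i^2 / (Ap)_i. Together with Perron-Frobenius for
   the irreducible matrix A, this forces A <= 0 on the A-orthogonal of p. *)

Require Import Defs.
From HB Require Import structures.
From mathcomp Require Import all_boot all_order all_algebra.
From mathcomp Require Import mpoly.
From mathcomp Require Import classical_sets reals topology normedtype convex.
From mathcomp Require Import complex spectral ring lra.
Set Implicit Arguments.
Unset Strict Implicit.
Unset Printing Implicit Defensive.
Import Order.TTheory GRing.Theory Num.Theory.
Import numFieldNormedType.Exports.
Local Open Scope classical_set_scope.
Local Open Scope ring_scope.

(** * Orthogonal diagonalisation of real symmetric matrices *)

Section SpectralTheorem.
Variable R : rcfType.

Lemma dotE n (x y : 'rV[R]_n) : (x *m y^T) 0 0 = \sum_i x 0 i * y 0 i.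
Proof. by rewrite mxE; apply: eq_bigr => i _; rewrite !mxE. Qed.

Lemma dot_ge0 n (x : 'rV[R]_n) : 0 <= (x *m x^T) 0 0.
Proof. by rewrite dotE sumr_ge0 // => i _; rewrite -expr2 sqr_ge0. Qed.

Lemma dot_eq0 n (x : 'rV[R]_n) : ((x *m x^T) 0 0 == 0) = (x == 0).
Proof.
rewrite dotE psumr_eq0 => [|i _]; last by rewrite -expr2 sqr_ge0.
apply/allP/eqP => [x0|-> i _]; last by rewrite /= !mxE mul0r eqxx.
apply/rowP => i; have := x0 i (mem_index_enum i).
by rewrite /= mulf_eq0 orbb [RHS]mxE => /eqP.
Qed.

Lemma dot_gt0 n (x : 'rV[R]_n) : (0 < (x *m x^T) 0 0) = (x != 0).
Proof. by rewrite lt_def dot_ge0 andbT dot_eq0. Qed.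

Lemma form_sym n (A : 'M[R]_n) (x y : 'rV[R]_n) :
  A^T = A -> (x *m A *m y^T) 0 0 = (y *m A *m x^T) 0 0.
Proof.
by move=> symA; rewrite -[in LHS](trmxK (x *m A *m y^T)) mxE !trmx_mul trmxK
  symA mulmxA.
Qed.

(** An eigenvector exists over the algebraically closed field [R[i]]. Symmetry makes its eigenvalue
    real, so its real and imaginary parts are both eigenvectors unless zero, and at least one is
    nonzero. *)
Lemma sym_real_eigenvector n (A : 'M[R]_n.+1) : A^T = A ->
  exists a, exists2 v : 'rV[R]_n.+1, v != 0 & v *m A = a *: v.
Proof.
move=> symA; pose B : 'M[R[i]]_n.+1 := map_mx (real_complex R) A.
have [z /eigenvalueP [v vB v0]] := eigenvalue_closed B (ltn0Sn n).
pose x := map_mx (@complex.Re R) v; pose y := map_mx (@complex.Im R) v.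
pose a := complex.Re z; pose b := complex.Im z.
have reM (p q : R[i]) : complex.Re (p * q)
    = complex.Re p * complex.Re q - complex.Im p * complex.Im q.
  by case: p q => [? ?] [? ?].
have imM (p q : R[i]) : complex.Im (p * q)
    = complex.Im p * complex.Re q + complex.Re p * complex.Im q.
  by case: p q => [? ?] [? ?] /=; rewrite addrC.
have xA : x *m A = a *: x - b *: y.
  apply/rowP => j; move/rowP/(_ j)/(congr1 (@complex.Re R)): vB.
  rewrite !mxE raddf_sum reM /= => <-; apply: eq_bigr => k _.
  by rewrite reM !mxE /= mulr0 subr0.
have yA : y *m A = b *: x + a *: y.
  apply/rowP => j; move/rowP/(_ j)/(congr1 (@complex.Im R)): vB.
  rewrite !mxE raddf_sum imM /= => <-; apply: eq_bigr => k _.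
  by rewrite imM !mxE /= mulr0 addr0.
have xy0 : (x != 0) || (y != 0).
  rewrite -negb_and; apply: contra v0 => /andP[/eqP x0 /eqP y0].
  apply/eqP/rowP => j; rewrite mxE.
  move/rowP/(_ j): x0; move/rowP/(_ j): y0; rewrite !mxE.
  by case: (v 0 j) => ? ? /= -> ->.
(* Expanding (xA).y = (yA).x with [xA] and [yA] leaves b (|x|^2 + |y|^2) = 0. *)
have b0 : b = 0.
  have := form_sym x y symA; rewrite xA yA !(mulmxDl, mulmxBl) mulNmx
    -!scalemxAl.
  have -> : y *m x^T = x *m y^T.
    by rewrite [LHS]mx11_scalar [RHS]mx11_scalar -[y]mulmx1 form_sym ?mulmx1
      // trmx1.
  rewrite !mxE => e.
  have {}e : b * ((x *m x^T) 0 0 + (y *m y^T) 0 0) = 0.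
    by rewrite !mxE; lra.
  move/eqP: e; rewrite mulf_eq0 => /orP[/eqP //|].
  rewrite paddr_eq0 ?dot_ge0 // !dot_eq0 => /andP[/eqP x0 /eqP y0].
  by rewrite x0 y0 eqxx in xy0.
rewrite b0 !scale0r ?subr0 ?add0r in xA yA.
by exists a; case/orP: xy0 => [x0|y0]; [exists x | exists y].
Qed.

(** The reflection in the hyperplane orthogonal to v - e exchanges the unit vectors e and v. It is
    undefined when v = e, where the identity serves. *)
Lemma householder n (v : 'rV[R]_n.+1) : v *m v^T = 1%:M ->
  exists Q : 'M[R]_n.+1, [/\ Q^T = Q, Q *m Q = 1%:M & delta_mx 0 0 *m Q = v].
Proof.
move=> v1; set e := delta_mx 0 0; have [->|ve] := eqVneq v e.
  by exists 1%:M; rewrite trmx1 !mulmx1.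
pose u := v - e; have u0 : u *m u^T != 0.
  apply: contra ve => /eqP/matrixP/(_ 0 0)/eqP.
  by rewrite [X in _ == X]mxE dot_eq0 subr_eq0.
pose s := (u *m u^T) 0 0; have s0 : s != 0.
  by apply: contra u0; rewrite [u *m u^T]mx11_scalar -/s => /eqP ->;
    rewrite raddf0.
have uu : u *m u^T = s%:M by rewrite [LHS]mx11_scalar.
have ee : e *m e^T = 1%:M.
  by rewrite trmx_delta mul_delta_mx; apply/matrixP=> i j; rewrite !mxE !ord1.
have ve0 : v *m e^T = e *m v^T.
  by rewrite [LHS]mx11_scalar [RHS]mx11_scalar -[v]mulmx1 form_sym ?mulmx1 //
    trmx1.
(* Since |e| = |v| = 1, s = |v - e|^2 = 2 - 2 e.v, hence e.u = e.v - 1 = - s / 2. This makes the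
   reflection send e to e + u = v. *)
have eu : e *m u^T = (- s / 2)%:M.
  have -> : s = 2 - 2 * (e *m v^T) 0 0.
    rewrite /s /u linearB /= !(mulmxBl, mulmxBr) ve0 v1 ee !mxE /=.
    by rewrite mulr1n; ring.
  rewrite [LHS]mx11_scalar /u linearB /= mulmxBr ee; congr (_%:M).
  by rewrite !mxE mulr1n; field.
have euv : e + u = v by rewrite addrC subrK.
clearbody u; exists (1%:M - (2 / s) *: (u^T *m u)); split.
- by rewrite linearB /= linearZ /= trmx_mul trmxK trmx1.
- rewrite mulmxBl mul1mx mulmxBr mulmx1 -scalemxAl -scalemxAr.
  rewrite -mulmxA (mulmxA u) uu mul_scalar_mx -scalemxAr !scalerA.
  rewrite (_ : _ * (_ * s) = 2 / s * 2); last by field.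
  by apply/matrixP => i j; rewrite !mxE; ring.
- rewrite mulmxBr mulmx1 -scalemxAr mulmxA eu mul_scalar_mx scalerA.
  rewrite (_ : 2 / s * _ = -1); last by field.
  by rewrite scaleN1r opprK.
Qed.

(** Induction on the size: a reflection moves a unit eigenvector to the first basis vector, and
    symmetry then splits off a 1 x 1 block. *)
Theorem sym_spectral n (A : 'M[R]_n) : A^T = A ->
  exists (P : 'M[R]_n) (d : 'rV[R]_n),
    P *m P^T = 1%:M /\ A = P^T *m diag_mx d *m P.
Proof.
elim: n A => [|n IHn] A symA.
  by exists 1%:M, 0; split; apply/matrixP => [] [].
have [a [w w0 wA]] := sym_real_eigenvector symA.
pose s := Num.sqrt ((w *m w^T) 0 0).
have s0 : s != 0 by rewrite gt_eqF // sqrtr_gt0 dot_gt0.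
pose v := s^-1 *: w.
have vA : v *m A = a *: v by rewrite /v -scalemxAl wA !scalerA mulrC.
have v1 : v *m v^T = 1%:M.
  rewrite /v linearZ /= -scalemxAl -scalemxAr scalerA [w *m _]mx11_scalar.
  rewrite -(sqr_sqrtr (dot_ge0 w)) -/s scale_scalar_mx; congr (_%:M).
  by field.
have [Q [symQ QQ eQ]] := householder v1.
(* The type ['M_(1 + n)] gives access to the block operations, and the existential keeps [M]
   opaque. *)
have [M QAQ] : {M : 'M_(1 + n) | M = Q *m A *m Q} by exists (Q *m A *m Q).
have symM : M^T = M by rewrite QAQ !trmx_mul symQ symA mulmxA.
have row0M : delta_mx 0 0 *m M = a *: delta_mx 0 0 :> 'rV_n.+1.
  by rewrite QAQ !mulmxA eQ vA -scalemxAl -eQ -mulmxA QQ mulmx1.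
have M0 i j : M (lshift n i) j = a * (lshift n i == j)%:R.
  have -> : lshift n i = 0 by apply/val_inj; rewrite /= ord1.
  by move/rowP/(_ j): row0M; rewrite -rowE !mxE eqxx /= eq_sym.
have defM : M = block_mx a%:M 0 0 (drsubmx M).
  rewrite -[LHS]submxK; congr block_mx; apply/matrixP => i j; rewrite !mxE.
  - by rewrite M0 (inj_eq (@lshift_inj _ _)) mulr_natr.
  - by rewrite M0 eq_lrshift mulr0.
  - by rewrite -symM mxE M0 eq_lrshift mulr0.
have symM' : (drsubmx M)^T = drsubmx M by rewrite trmx_drsub symM.
have [P' [d' [PP' dM']]] := IHn _ symM'.
pose P0 : 'M_(1 + n) := block_mx 1%:M 0 0 P'.
have P0P0 : P0 *m P0^T = 1%:M.
  rewrite tr_block_mx mulmx_block !trmx0 trmx1 PP'.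
  by rewrite !(mulmx0, mul0mx, addr0, add0r, mulmx1) -scalar_mx_block.
have P0M : P0^T *m diag_mx (row_mx a%:M d') *m P0 = M.
  rewrite defM dM' diag_mx_row tr_block_mx !mulmx_block.
  rewrite !trmx0 trmx1 !(mulmx0, mul0mx, addr0, add0r, mulmx1, mul1mx).
  by congr block_mx; apply/matrixP=> i j; rewrite !mxE !ord1.
exists (P0 *m Q), (row_mx a%:M d'); split.
  by rewrite trmx_mul symQ mulmxA -(mulmxA P0) QQ mulmx1.
rewrite trmx_mul symQ.
transitivity (Q *m M *m Q); last by rewrite -P0M !mulmxA.
by rewrite QAQ !mulmxA QQ mul1mx -mulmxA QQ mulmx1.
Qed.

End SpectralTheorem.

(** * Quadratic forms with exactly one positive eigenvalue *)

Section OnePositiveEigenvalue.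
Variables (R : realType) (n : nat).
Implicit Types (A P : 'M[R]_n) (x y p d : 'rV[R]_n).

Definition bil A x y : R := (x *m A *m y^T) 0 0.

Lemma bilC A x y : A^T = A -> bil A x y = bil A y x.
Proof. exact: form_sym. Qed.

Lemma bilDl A x y z : bil A (x + y) z = bil A x z + bil A y z.
Proof. by rewrite /bil !mulmxDl mxE. Qed.

Lemma bilDr A x y z : bil A z (x + y) = bil A z x + bil A z y.
Proof. by rewrite /bil linearD mulmxDr mxE. Qed.

Lemma bilZl A a x y : bil A (a *: x) y = a * bil A x y.
Proof. by rewrite /bil -!scalemxAl mxE. Qed.

Lemma bilZr A a x y : bil A x (a *: y) = a * bil A x y.
Proof. by rewrite /bil linearZ -scalemxAr mxE. Qed.

Lemma bil_diag P d x y : bil (P^T *m diag_mx d *m P) x y =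
  \sum_i d 0 i * ((x *m P^T) 0 i * (y *m P^T) 0 i).
Proof.
rewrite /bil !mulmxA -mulmxA.
have -> : P *m y^T = (y *m P^T)^T by rewrite trmx_mul trmxK.
rewrite mxE; apply: eq_bigr => i _.
by rewrite mul_mx_diag [in RHS]mulrA !mxE [d 0 i * _]mulrC.
Qed.

Lemma char_poly_diag P d : P *m P^T = 1%:M ->
  char_poly (P^T *m diag_mx d *m P) = \prod_i ('X - (d 0 i)%:P).
Proof.
move=> PP; have PP' : P^T *m P = 1%:M by apply: mulmx1C.
have defX : char_poly_mx (P^T *m diag_mx d *m P) =
    map_mx polyC P^T *m char_poly_mx (diag_mx d) *m map_mx polyC P.
  rewrite /char_poly_mx mulmxBr mulmxBl -!map_mxM; congr (_ - _).
  by rewrite mul_mx_scalar -scalemxAl -map_mxM PP' map_mx1 scalemx1.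
rewrite /char_poly defX !det_mulmx mulrC mulrA -det_mulmx -map_mxM PP map_mx1.
rewrite det1 mul1r; transitivity (char_poly (diag_mx d)) => //.
rewrite (char_poly_trig (diag_mx_is_trig d)); apply: eq_bigr => i _.
by rewrite mxE eqxx mulr1n.
Qed.

Lemma mup_prod_XsubC (I : finType) (d : I -> R) a :
  mup a (\prod_i ('X - (d i)%:P)) = (\sum_i (d i == a))%N.
Proof.
(* Nonvanishing is carried along because multiplicities add only for nonzero factors. *)
pose Q (q : {poly R}) (k : nat) := q != 0 /\ mup a q = k.
suff: Q (\prod_i ('X - (d i)%:P)) (\sum_i (d i == a))%N by case.
apply: (big_ind2 Q); rewrite /Q.
- by rewrite oner_neq0; split=> //; apply: mupNroot; rewrite root1.
- by move=> q j r k [q0 <-] [r0 <-]; rewrite mulf_neq0 // mupM.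
- move=> i _; rewrite polyXsubC_eq0; split=> //.
  by rewrite -['X - _]expr1 mup_XsubCX; case: eqP.
Qed.

(** The multiplicity of a in the characteristic polynomial counts the indices i with d_i = a, so a
    simple and unique positive eigenvalue amounts to a single index with d_i > 0. *)
Lemma one_positive_eigenvalueE P d : P *m P^T = 1%:M ->
  one_positive_eigenvalue (P^T *m diag_mx d *m P) <->
  exists i, 0 < d 0 i /\ forall j, j != i -> d 0 j <= 0.
Proof.
move=> PP; set A := _ *m _ *m P.
have eigA a : eigenvalue A a <-> exists i, d 0 i = a.
  rewrite eigenvalue_root_char char_poly_diag // rootE horner_prod.
  split=> [/prodf_eq0 [i _]|[i da]]; last first.
    by apply/prodf_eq0; exists i => //; rewrite hornerXsubC da subrr.
  by rewrite hornerXsubC subr_eq0 => /eqP ->; exists i.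
have mupA a : mup a (char_poly A) = (\sum_i (d 0%R i == a))%N.
  by rewrite char_poly_diag // mup_prod_XsubC.
split=> [[a [a0 /eigA [i da]]]|[i [di0 dj]]].
  rewrite mupA (bigD1 i) //= da eqxx add1n => -[/eqP].
  rewrite sum_nat_eq0 => /forallP ne uniqa; exists i; rewrite da;
    split=> // j ji.
  rewrite leNgt; apply/negP => dj0.
  have /= := ne j; rewrite ji /= (uniqa (d 0 j)) ?eqxx //.
  by apply/eigA; exists j.
exists (d 0 i); split=> //; first by apply/eigA; exists i.
  rewrite mupA (bigD1 i) //= eqxx big1 ?addn0 // => j ji.
  by case: eqP (dj j ji) => // ->; rewrite leNgt di0.
move=> b b0 /eigA [j db]; have [ji|ji] := eqVneq j i.
  by rewrite -db ji.
by have := dj j ji; rewrite db leNgt b0.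
Qed.

(** The form is nonpositive on vectors without component along the positive eigenvector. Subtracting
    a multiple of p from x produces such a vector, as p itself must have that component. *)
Lemma reverse_cauchy_schwarz A x p :
  A^T = A -> one_positive_eigenvalue A -> 0 < bil A p p ->
  bil A x x * bil A p p <= bil A x p ^+ 2.
Proof.
move=> symA; have [P [d [PP defA]]] := sym_spectral symA.
rewrite [in one_positive_eigenvalue A]defA one_positive_eigenvalueE //.
move=> [i [di dj]] pp.
have neg y : (y *m P^T) 0 i = 0 -> bil A y y <= 0.
  move=> yi; rewrite defA bil_diag; apply: sumr_le0 => j _.
  have [->|ji] := eqVneq j i; first by rewrite yi mul0r mulr0.
  by rewrite mulr_le0_ge0 ?dj // -expr2 sqr_ge0.
have pi0 : (p *m P^T) 0 i != 0.
  by apply: contraTneq pp => /neg; rewrite leNgt.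
pose t := (x *m P^T) 0 i / (p *m P^T) 0 i.
have /neg : ((x - t *: p) *m P^T) 0 i = 0.
  rewrite mulmxBl -scalemxAl /t; move: (x *m _) (p *m _) pi0 => a b b0.
  by rewrite !mxE mulfVK ?subrr.
rewrite -scaleNr !(bilDl, bilDr, bilZl, bilZr) (bilC p x symA).
move: (bil A x x) (bil A x p) (bil A p p) pp => a b c c0 h.
have : c * (a + - t * b + (- t * b + - t * (- t * c))) <= 0.
  by rewrite pmulr_rle0 //; apply: le_trans h; rewrite le_eqVlt; apply/orP;
    left; apply/eqP; ring.
(* The previous inequality reads a c <= 2 t b c - t^2 c^2 = b^2 - (b - t c)^2. *)
have := sqr_ge0 (b - t * c).
nra.
Qed.

(** Two eigenvectors with positive eigenvalues would span a plane on which the form is positive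
    definite, and this plane meets the hyperplane A-orthogonal to p in a nonzero vector. *)
Lemma one_positive_eigenvalue_hyperplane A p : A^T = A -> 0 < bil A p p ->
  (forall x, bil A x p = 0 -> bil A x x <= 0) -> one_positive_eigenvalue A.
Proof.
move=> symA pp neg; have [P [d [PP defA]]] := sym_spectral symA.
have rowP i j : (row i P *m P^T) 0 j = (i == j)%:R.
  by rewrite -row_mul PP row1 mxE eqxx eq_sym.
have brow i j : bil A (row i P) (row j P) = d 0 i * (i == j)%:R.
  rewrite defA bil_diag (bigD1 i) //= big1 ?addr0 => [|k ki].
    by rewrite !rowP eqxx mul1r eq_sym.
  by rewrite !rowP eq_sym (negPf ki) mul0r mulr0.
have rowp i : 0 < d 0 i -> bil A (row i P) p != 0.
  move=> di; apply: contraTneq di => /neg.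
  by rewrite brow eqxx mulr1 leNgt.
rewrite defA one_positive_eigenvalueE //.
have [i di] : exists i, 0 < d 0 i.
  apply/existsP; apply: contraTT pp; rewrite negb_exists -leNgt => /forallP nd.
  rewrite defA bil_diag; apply: sumr_le0 => i _.
  by apply: mulr_le0_ge0; [rewrite leNgt | rewrite -expr2 sqr_ge0].
exists i; split=> // j ji; rewrite leNgt; apply/negP => dj.
(* The vector b_j P_i - b_i P_j, with P_k the k-th row, is A-orthogonal to p. Its value b_j^2 d_i +
   b_i^2 d_j is positive because b_j is nonzero by [rowp]. *)
pose b k := bil A (row k P) p.
have /neg : bil A (b j *: row i P - b i *: row j P) p = 0.
  by rewrite -scaleNr bilDl !bilZl -/(b i) -/(b j); ring.
rewrite -scaleNr !(bilDl, bilDr, bilZl, bilZr) !brow !eqxx.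
rewrite (negPf ji) eq_sym (negPf ji) !(mulr0, mulr1, addr0, add0r) leNgt.
rewrite !mulNr !mulrN opprK !mulrA ltr_pwDl //.
  by rewrite mulr_gt0 // -expr2 exprn_even_gt0 //= rowp.
by apply: mulr_ge0 (ltW dj); rewrite -expr2 sqr_ge0.
Qed.

End OnePositiveEigenvalue.

(** * Perron-Frobenius theory for irreducible symmetric matrices *)

Section PerronFrobenius.
Variables (R : realType) (n : nat).
Implicit Types (A : 'M[R]_n) (x y p : 'rV[R]_n).

(** A connecting path has consecutive indices distinct, so its entries are nonnegative, and their
    positive product forces each to be positive; g is thus preserved at every step. *)
Lemma irreducible_mx_const (T : Type) A (g : 'I_n -> T) :
  irreducible_mx A -> offdiag_nonneg A ->
  (forall i j, i != j -> 0 < A i j -> g i = g j) -> forall i j, g i = g j.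
Proof.
move=> irrA A_ge0 gA i j; have [-> //|ij] := eqVneq i j.
have [s [ps <- {ij}]] := irrA i j ij.
suff: 0 <= \prod_(a <- pairmap A i s) a /\
  (0 < \prod_(a <- pairmap A i s) a -> g i = g (last i s)) by case.
elim: s i ps => [|k s IHs] i /=; first by rewrite big_nil.
case/andP=> ik /IHs [ge0 IH]; rewrite big_cons; split.
  by rewrite mulr_ge0 ?A_ge0.
have [->|Aik] := eqVneq (A i k) 0; first by rewrite mul0r ltxx.
have Aik0 : 0 < A i k by rewrite lt_def Aik A_ge0.
by rewrite pmulr_rgt0 // => /IH <-; exact: gA.
Qed.

(** Dirichlet form of y / p on the graph with edge weights A_ij p_i p_j. Each summand expands to
    A_ij (p_j y_i^2 / p_i + p_i y_j^2 / p_j - 2 y_i y_j), and symmetry makes the first two kinds of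
    terms sum to the same value. *)
Lemma dirichlet_form A p y : A^T = A -> (forall i, p 0 i != 0) ->
  \sum_i \sum_j A i j * (p 0 i * p 0 j) * (y 0 i / p 0 i - y 0 j / p 0 j) ^+ 2
  = 2 * (\sum_i y 0 i ^+ 2 / p 0 i * (p *m A) 0 i - bil A y y).
Proof.
move=> symA p0; have Aji i j : A i j = A j i by rewrite -{1}symA mxE.
pose F i j := A i j * (p 0 j * y 0 i ^+ 2 / p 0 i).
pose G i j := A i j * (y 0 i * y 0 j).
transitivity (\sum_i \sum_j (F i j + F j i - 2 * G i j)).
  apply: eq_bigr => i _; apply: eq_bigr => j _.
  by rewrite /F /G (Aji j i); field; rewrite !p0.
have defF : \sum_i \sum_j F i j = \sum_i y 0 i ^+ 2 / p 0 i * (p *m A) 0 i.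
  apply: eq_bigr => i _; rewrite mxE mulr_sumr; apply: eq_bigr => j _.
  by rewrite /F (Aji i j); field; rewrite p0.
have defG : \sum_i \sum_j G i j = bil A y y.
  rewrite /bil mxE exchange_big; apply: eq_bigr => j _ /=.
  rewrite mxE mulr_suml; apply: eq_bigr => i _.
  by rewrite !mxE /G; ring.
under eq_bigr do rewrite sumrB big_split /= -mulr_sumr.
rewrite sumrB big_split /= -mulr_sumr defG.
by rewrite [X in _ + X - _]exchange_big /= defF; ring.
Qed.

(** The hypothesis on y is a generalised eigenvalue equation solved by p itself with a = 1. The
    Dirichlet form of y equals 2 (1 - a) N with N > 0: its sign gives a <= 1, and its vanishing
    makes y / p constant along edges, hence constant by irreducibility. *)
Lemma perron A p y a : A^T = A -> irreducible_mx A -> offdiag_nonneg A ->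
  (forall i, 0 < p 0 i) -> (forall i, 0 < (p *m A) 0 i) -> y != 0 ->
  (forall i, (y *m A) 0 i = a * (y 0 i * (p *m A) 0 i / p 0 i)) ->
  a <= 1 /\ (a = 1 -> exists c, y = c *: p).
Proof.
move=> symA irrA A_ge0 p_gt0 pA_gt0 y0 yA.
have p0 i : p 0 i != 0 by rewrite gt_eqF.
pose N := \sum_i y 0 i ^+ 2 / p 0 i * (p *m A) 0 i.
have N_ge0 i : 0 <= y 0 i ^+ 2 / p 0 i * (p *m A) 0 i.
  by rewrite mulr_ge0 ?divr_ge0 ?sqr_ge0 // ltW.
have N_gt0 : 0 < N.
  rewrite lt_def sumr_ge0 // andbT; apply: contra y0.
  rewrite psumr_eq0 // => /allP /= N0; apply/eqP/rowP => i; rewrite mxE.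
  have := N0 i (mem_index_enum i).
  rewrite !mulf_eq0 invr_eq0 (gt_eqF (p_gt0 i)) (gt_eqF (pA_gt0 i)) !orbF.
  by rewrite orbb => /eqP.
have := dirichlet_form y symA p0; rewrite -/N.
have -> : bil A y y = a * N.
  rewrite /bil mxE mulr_sumr; apply: eq_bigr => i _.
  by rewrite yA [y^T _ _]mxE; field.
set F := fun i j => A i j * (p 0 i * p 0 j) * (y 0 i / p 0 i - y 0 j / p 0 j)
  ^+ 2.
have F_ge0 i j : 0 <= F i j.
  (* Diagonal entries of A may be negative, but their difference factor vanishes. *)
  have [->|ij] := eqVneq i j; first by rewrite /F subrr expr0n mulr0.
  by rewrite /F mulr_ge0 ?sqr_ge0 // mulr_ge0 ?A_ge0 // mulr_ge0 // ltW.
move=> sumF; split.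
  rewrite -subr_ge0 -(pmulr_lge0 _ N_gt0) -(pmulr_rge0 _ (ltr0Sn R 1)).
  rewrite mulrBl mul1r -sumF.
  by apply: sumr_ge0 => i _; apply: sumr_ge0 => j _; exact: F_ge0.
move=> a1; move/eqP: sumF; rewrite a1 mul1r subrr mulr0.
rewrite psumr_eq0 => [/allP sumF|i _]; last by apply: sumr_ge0 => j _;
  exact: F_ge0.
have F0 i j : F i j = 0.
  have := sumF i (mem_index_enum i).
  rewrite /= psumr_eq0 => [/allP /(_ j (mem_index_enum j)) /eqP //|k _].
  exact: F_ge0.
have cst := @irreducible_mx_const _ _ (fun i => y 0 i / p 0 i) irrA A_ge0.
(* The ratio is read off at an arbitrary index; without any index, all vectors are equal. *)
case: (pickP 'I_n) => [i0 _|n0]; last first.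
  by exists 0; apply/rowP => i; have := n0 i.
exists (y 0 i0 / p 0 i0); apply/rowP => i; rewrite !mxE.
rewrite -(cst _ i) ?mulfVK // => j k jk Ajk.
have /eqP := F0 j k; rewrite mulf_eq0 expf_eq0 subr_eq0 /= => /orP[|/eqP //].
by rewrite gt_eqF // !mulr_gt0.
Qed.

(* With S = diag (sqrt (p_i / (pA)_i)) the hypothesis reads B <= B ^ 2 for
   B = S A S, so that every positive eigenvalue of B is at least 1, whereas
   p S^-1 is a Perron eigenvector of B with eigenvalue 1. *)
Lemma perron_hyperplane A p :
  A^T = A -> irreducible_mx A -> offdiag_nonneg A ->
  (forall i, 0 < p 0 i) -> (forall i, 0 < (p *m A) 0 i) ->
  (forall x, bil A x x <= \sum_i p 0 i * (x *m A) 0 i ^+ 2 / (p *m A) 0 i) ->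
  forall x, bil A x p = 0 -> bil A x x <= 0.
Proof.
move=> symA irrA A_ge0 p_gt0 pA_gt0 leA x xp.
pose s := \row_i Num.sqrt (p 0 i / (p *m A) 0 i).
have s_gt0 i : 0 < s 0 i by rewrite mxE sqrtr_gt0 divr_gt0.
have s0 i : s 0 i != 0 by rewrite gt_eqF.
have s2 i : s 0 i ^+ 2 = p 0 i / (p *m A) 0 i.
  by rewrite mxE sqr_sqrtr // divr_ge0 // ltW.
clearbody s; pose B := diag_mx s *m A *m diag_mx s.
have symB : B^T = B by rewrite /B !trmx_mul symA tr_diag_mx mulmxA.
have bilB y z : bil B y z = bil A (y *m diag_mx s) (z *m diag_mx s).
  by rewrite /bil /B trmx_mul tr_diag_mx !mulmxA.
have [P [d [PP defB]]] := sym_spectral symB.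
have eigB i : row i P *m B = d 0 i *: row i P.
  rewrite defB -row_mul !mulmxA PP mul1mx; apply/rowP => j.
  by rewrite mul_diag_mx !mxE.
have dotP i : \sum_k P i k ^+ 2 = 1.
  transitivity ((P *m P^T) i i); last by rewrite PP mxE eqxx.
  by rewrite mxE; apply: eq_bigr => k _; rewrite [P^T _ _]mxE.
pose y i := row i P *m diag_mx s.
have yE i k : y i 0 k = P i k * s 0 k by rewrite /y mul_mx_diag !mxE.
have yAs i k : (y i *m A) 0 k * s 0 k = d 0 i * P i k.
  have /rowP/(_ k) := eigB i; rewrite /B !mulmxA -/(y i) mul_mx_diag.
  by rewrite mxE => ->; rewrite !mxE.
have y_neq0 i : y i != 0.
  apply: contraTneq (oner_neq0 R) => y_0;
    rewrite negbK -(dotP i) big1 // => k _.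
  by have /eqP := yE i k; rewrite y_0 mxE eq_sym mulf_eq0 (negPf (s0 k)) orbF
    => /eqP ->; rewrite expr0n.
have bily i : bil A (y i) (y i) = d 0 i.
  rewrite /bil mxE -[RHS]mulr1 -(dotP i) mulr_sumr; apply: eq_bigr => k _.
  by rewrite [_^T _ _]mxE yE mulrCA yAs; ring.
(* This is [leA] at y_i: by [yAs], the k-th summand on the right is d_i^2 P_ik^2, and the rows of P
   have norm 1. *)
have d_le i : d 0 i <= d 0 i ^+ 2.
  rewrite -{1}bily (le_trans (leA _)) // -[leRHS]mulr1 -(dotP i) mulr_sumr.
  rewrite le_eqVlt; apply/orP; left; apply/eqP; apply: eq_bigr => k _.
  by rewrite mulrAC -s2 mulrC -exprMn yAs exprMn.
(* The eigenvector equation for B, rewritten through y_i = P_i S, is the hypothesis of [perron] with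
   a = d_i. *)
have yA i k : (y i *m A) 0 k = d 0 i * (y i 0 k * (p *m A) 0 k / p 0 k).
  apply: (mulIf (s0 k)); rewrite yAs -[_ * (p *m A) 0 k / _]mulrA
    -[_ / p 0 k]invf_div -s2 yE.
  by field.
pose z := x *m diag_mx (\row_k (s 0 k)^-1).
have zx : z *m diag_mx s = x.
  by apply/rowP => k; rewrite /z !mul_mx_diag !mxE divfK.
rewrite -zx -bilB defB bil_diag; apply: sumr_le0 => i _.
(* For d_i > 0, [d_le] gives d_i >= 1 and [perron] gives d_i <= 1. Then y_i is a multiple of p, so
   the i-th coordinate of z equals B(z, P_i) = A(x, y_i) = 0. *)
have [di|di] := lerP (d 0 i) 0.
  by rewrite mulr_le0_ge0 // -expr2 sqr_ge0.
have [d_le1 d1] := perron symA irrA A_ge0 p_gt0 pA_gt0 (y_neq0 i) (yA i).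
have di1 : d 0 i = 1.
  by apply/eqP; rewrite eq_le d_le1 -(ler_pM2l di) mulr1 -expr2 d_le.
have [c yc] := d1 di1.
suff -> : (z *m P^T) 0 i = 0 by rewrite mul0r mulr0.
transitivity (bil B z (row i P)).
  rewrite bilC // /bil eigB di1 scale1r mxE [RHS]mxE; apply: eq_bigr => k _.
  by rewrite [P^T _ _]mxE [z^T _ _]mxE [row _ _ _ _]mxE mulrC.
by rewrite bilB zx -/(y i) yc bilZr xp mulr0.
Qed.

End PerronFrobenius.

(** * Directional derivatives and invariance under translation *)

Section DirectionalDerivatives.
Variables (R : realType) (n : nat).
Implicit Types (f g : {mpoly R[n]}) (u v w x y : 'rV[R]_n) (vs : seq 'rV[R]_n).

Lemma dirderiv_is_linear u : linear (dirderiv u).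
Proof.
move=> c f g; rewrite /dirderiv scaler_sumr -big_split; apply: eq_bigr => i _.
by rewrite mderivD mderivZ scalerDr !scalerA mulrC.
Qed.

HB.instance Definition _ u := GRing.isLinear.Build R {mpoly R[n]} {mpoly R[n]}
  _ (dirderiv u) (dirderiv_is_linear u).

Lemma dirderivDl u v f : dirderiv (u + v) f = dirderiv u f + dirderiv v f.
Proof.
by rewrite /dirderiv -big_split; apply: eq_bigr => i _; rewrite mxE scalerDl.
Qed.

Lemma dirderiv_delta i f : dirderiv 'e_i f = f^`M(i).
Proof.
rewrite /dirderiv (bigD1 i) //= big1 ?addr0 => [|j ji].
  by rewrite mxE !eqxx scale1r.
by rewrite mxE (negPf ji) andbF scale0r.
Qed.

Lemma dirderivM u f g :
  dirderiv u (f * g) = dirderiv u f * g + f * dirderiv u g.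
Proof.
rewrite /dirderiv mulr_suml mulr_sumr -big_split; apply: eq_bigr => i _ /=.
by rewrite mderivM scalerDr -scalerAl -scalerAr.
Qed.

Lemma dirderivC u v f : dirderiv u (dirderiv v f) = dirderiv v (dirderiv u f).
Proof.
have dd a b : dirderiv a (dirderiv b f)
    = \sum_i \sum_j (a 0 i * b 0 j) *: f^`M(j)^`M(i).
  rewrite {1}/dirderiv; apply: eq_bigr => i _.
  rewrite (raddf_sum (mderiv i)) scaler_sumr; apply: eq_bigr => j _.
  by rewrite /= mderivZ scalerA.
rewrite !dd exchange_big; apply: eq_bigr => j _; apply: eq_bigr => i _ /=.
by rewrite mderiv_comm mulrC.
Qed.

Lemma dirderiv_dirderivs u vs f :
  dirderiv u (dirderivs vs f) = dirderivs vs (dirderiv u f).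
Proof. by elim: vs => //= v vs IHvs; rewrite dirderivC IHvs. Qed.

Lemma dirderivs0 vs : dirderivs vs (0 : {mpoly R[n]}) = 0.
Proof. by elim: vs => //= v vs ->; rewrite raddf0. Qed.

Lemma dhomog_mderiv d i f : f \is d.+1.-homog -> f^`M(i) \is d.-homog.
Proof.
move=> /dhomogP homf; apply/dhomogP => m; rewrite mcoeff_msupp mcoeff_mderiv.
move=> c0; suff /homf : (m + U_(i))%MM \in msupp f.
  by rewrite /= mdegD mdeg1 addn1 => -[].
by rewrite mcoeff_msupp; apply: contra c0 => /eqP ->; rewrite mul0rn.
Qed.

(** The restriction t |-> f(x + t u), as a univariate polynomial, so that root counting applies to
    it. *)
Definition line_poly x u (f : {mpoly R[n]}) : {poly R} :=
  mmap polyC (fun i => (x 0 i)%:P + (u 0 i)%:P * 'X) f.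

Lemma horner_line_poly x u f t : (line_poly x u f).[t] = f.@[(x + t *: u) 0].
Proof.
rewrite /line_poly; elim/mpolyind: f => [|c m f _ _ IHf].
  by rewrite raddf0 meval0 horner0.
rewrite mmapD mevalD hornerD IHf mmapZ mevalZ hornerM hornerC mmapX mevalX.
congr (_ * _ + _); rewrite /mmap1 horner_prod; apply: eq_bigr => i _.
by rewrite horner_exp !hornerE !mxE [t * _]mulrC.
Qed.

Lemma deriv_line_poly x u f :
  (line_poly x u f)^`() = line_poly x u (dirderiv u f).
Proof.
(* By the Leibniz rule on both sides [Q] is closed under products, so by linearity it is enough to
   check 1 and the variables. *)
pose Q g := (line_poly x u g)^`() = line_poly x u (dirderiv u g).
have QM g h : Q g -> Q h -> Q (g * h).
  by rewrite /Q dirderivM /line_poly !(rmorphM, rmorphD) /= derivM => -> ->.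
have Q1 : Q 1.
  rewrite /Q /line_poly rmorph1 /dirderiv derivC big1 ?raddf0 // => i _.
  by rewrite -mpolyC1 mderivC scaler0.
have QX i : Q 'X_i.
  rewrite /Q /line_poly mmapX mmap1U /dirderiv (bigD1 i) //= big1 ?addr0 =>
    [|j ji].
    by rewrite mderivX mnm1E eqxx -[X in (X - _)%MM]add0m addmK mpolyX0
      scale1r mmapZ rmorph1 !derivE add0r.
  by rewrite mderivX mnm1E eq_sym (negPf ji) !scale0r scaler0.
elim/mpolyind: f => [|c m f _ _ IHf].
  by rewrite /line_poly !raddf0.
rewrite linearP /line_poly mmapD derivD IHf [X in _ = X]mmapD.
congr (_ + _); rewrite !mmapZ derivM derivC mul0r add0r; congr (_ * _).
rewrite mpolyXE_id; apply: (big_ind Q) => // i _.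
by elim: (m i) => [|k IHk]; rewrite ?expr0 // exprS; apply: QM.
Qed.

Lemma poly_nat_roots (q : {poly R}) : (forall k : nat, q.[k%:R] = 0) -> q = 0.
Proof.
move=> q0; apply: (@roots_geq_poly_eq0 _ _ [seq k%:R | k <- iota 0 (size q)]).
- by apply/allP => _ /mapP [k _ ->]; rewrite rootE q0.
- by rewrite map_inj_uniq ?iota_uniq //; exact: mulrIn (oner_neq0 R).
- by rewrite size_map size_iota.
Qed.

(** The restriction of f to the line takes the value a at every natural number, hence is constant;
    its derivative at 0 is the derivative sought. *)
Lemma dirderiv_meval_eq0 u x f a :
  (forall k : nat, f.@[(x + k%:R *: u) 0] = a) -> (dirderiv u f).@[x 0] = 0.
Proof.
move=> fa; have eql : line_poly x u f = a%:P.
  apply/eqP; rewrite -subr_eq0; apply/eqP/poly_nat_roots => k.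
  by rewrite hornerD hornerN hornerC horner_line_poly fa subrr.
have := horner_line_poly x u (dirderiv u f) 0.
by rewrite -deriv_line_poly eql derivC horner0 scale0r addr0.
Qed.

Lemma mnm_neq0 (m : 'X_{1..n}) : m != 0%MM -> exists i, m i != 0%N.
Proof.
move=> m0; apply/existsP; apply: contraNT m0;
  rewrite negb_exists => /forallP m0.
by apply/eqP/mnmP => i; rewrite mnm0E; have := m0 i; rewrite negbK => /eqP.
Qed.

Lemma meval00 f : f.@[(0 : 'rV[R]_n) 0] = f@_0%MM.
Proof.
elim/mpolyind: f => [|c m f _ _ IHf]; first by rewrite meval0 mcoeff0.
rewrite mevalD mcoeffD IHf mevalZ mcoeffZ mcoeffX mevalX; congr (_ * _ + _).
have [->|m0] := eqVneq m 0%MM.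
  by rewrite big1 // => i _; rewrite mnm0E expr0.
have [i mi] := mnm_neq0 m0.
by rewrite (bigD1 i) //= mxE expr0n (negPf mi) mul0r.
Qed.

(** Induction on the degree of the monomial m. The partial derivatives of f vanish everywhere too,
    and the coefficient of m in f, times the nonzero integer m_i, is the coefficient of m / X_i in
    the i-th one. *)
Lemma meval_eq0 f : (forall x, f.@[x 0] = 0) -> f = 0.
Proof.
move=> f0; apply/mpolyP => m; rewrite mcoeff0.
have [k] := ubnP (mdeg m); elim: k => // k IHk in f f0 m *; rewrite ltnS => mk.
have [m0|m0] := eqVneq m 0%MM.
  by rewrite m0 -meval00 f0.
have [i mi] := mnm_neq0 m0.
have mE : (m - U_(i) + U_(i))%MM = m by rewrite submK ?lep1mP.
have := mcoeff_mderiv i f (m - U_(i))%MM; rewrite mE IHk.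
- by move/esym/eqP; rewrite mulrn_eq0 => /eqP.
- move=> x; rewrite -dirderiv_delta.
  suff fx t : f.@[(x + t *: 'e_i) 0] = 0 by apply: dirderiv_meval_eq0.
  exact: f0.
- by apply: leq_trans mk; rewrite -{2}mE mdegD mdeg1 addn1.
Qed.

Lemma dirderiv_invariant w f :
  (forall x, f.@[(x + w) 0] = f.@[x 0]) -> dirderiv w f = 0.
Proof.
move=> fw; apply: meval_eq0 => x; apply: (@dirderiv_meval_eq0 _ _ _ f.@[x 0]).
elim=> [|k IHk]; first by rewrite scale0r addr0.
by rewrite -natr1 scalerDl scale1r addrA fw.
Qed.

End DirectionalDerivatives.

(** * The Hessian at the origin as a bilinear form *)

Section HessianForm.
Variables (R : realType) (n : nat).
Implicit Types (g : {mpoly R[n]}) (x y p : 'rV[R]_n).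

(** Common form of the Hessian in hypothesis (3), taken at the origin, and of the matrix in
    condition (H), which reads constant coefficients. *)
Definition hess0 g : 'M[R]_n := \matrix_(i, j) (g^`M(j)^`M(i))@_0%MM.

Lemma matrix_of_form_dirderiv g :
  matrix_of_form (fun x y => (dirderiv x (dirderiv y g))@_0%MM) = hess0 g.
Proof. by apply/matrixP => i j; rewrite !mxE !dirderiv_delta. Qed.

Lemma hessian0 g : hessian g 0 = hess0 g.
Proof. by apply/matrixP => i j; rewrite !mxE meval00. Qed.

Lemma hess0_sym g : (hess0 g)^T = hess0 g.
Proof. by apply/matrixP => i j; rewrite !mxE mderiv_comm. Qed.

Lemma mcoeff_dirderiv x g m :
  (dirderiv x g)@_m = \sum_i x 0 i * (g^`M(i))@_m.
Proof.
rewrite /dirderiv raddf_sum; apply: eq_bigr => i _; exact: mcoeffZ.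
Qed.

Lemma mulmx_hess0 x g i : (x *m hess0 g) 0 i = (dirderiv x g^`M(i))@_0%MM.
Proof.
by rewrite mxE mcoeff_dirderiv; apply: eq_bigr => j _; rewrite mxE.
Qed.

Lemma bil_hess0 x y g : bil (hess0 g) x y = (dirderiv x (dirderiv y g))@_0%MM.
Proof.
rewrite dirderivC mcoeff_dirderiv /bil mxE; apply: eq_bigr => i _.
by rewrite mulmx_hess0 [y^T _ _]mxE mulrC -!dirderiv_delta dirderivC.
Qed.

End HessianForm.

(** Combines reversed Cauchy-Schwarz for the partial derivatives with [perron_hyperplane]. The
    alternative of a zero partial derivative is present because the zero polynomial counts as
    Lorentzian. *)
Lemma hess0_dirderiv_one_positive_eigenvalue (R : realType) (n : nat)
    (G : {mpoly R[n]}) (p : 'rV[R]_n) :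
  (forall i, 0 < p 0 i) ->
  0 < bil (hess0 (dirderiv p G)) p p ->
  irreducible_mx (hess0 (dirderiv p G)) ->
  offdiag_nonneg (hess0 (dirderiv p G)) ->
  (forall i, G^`M(i) = 0 \/
     0 < bil (hess0 G^`M(i)) p p /\ one_positive_eigenvalue (hess0 G^`M(i))) ->
  one_positive_eigenvalue (hess0 (dirderiv p G)).
Proof.
set A := hess0 _ => p_gt0 pp irrA A_ge0 derG;
  have symA : A^T = A := hess0_sym _.
have xA x i : (x *m A) 0 i = bil (hess0 G^`M(i)) x p.
  by rewrite mulmx_hess0 bil_hess0 -!dirderiv_delta [dirderiv 'e_i _]dirderivC.
have bilA x : bil A x x = \sum_i p 0 i * bil (hess0 G^`M(i)) x x.
  rewrite bil_hess0 [dirderiv x (dirderiv p _)]dirderivC dirderivC.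
  rewrite mcoeff_dirderiv; apply: eq_bigr => i _.
  by rewrite bil_hess0 -!dirderiv_delta ![dirderiv 'e_i _]dirderivC.
(* If the i-th partial derivative of G vanished, row and column i of A would be zero.
   Irreducibility, applied to the indicator of i, would leave i as the only index, making A zero
   against [pp]. *)
have derG_pos i : 0 < bil (hess0 G^`M(i)) p p /\
    one_positive_eigenvalue (hess0 G^`M(i)).
  case: (derG i) => // Gi0.
  have xAi (x : 'rV[R]_n) : (x *m A) 0 i = 0.
    by rewrite xA bil_hess0 Gi0 !raddf0.
  have Ai j : A j i = 0 by have := xAi 'e_j; rewrite -rowE mxE.
  have Ai' j : A i j = 0 by rewrite -symA mxE Ai.
  have all_i j : j = i.
    apply/eqP; suff: (j == i) = (i == i) by rewrite eqxx.
    apply: (irreducible_mx_const (g := fun j => j == i) irrA A_ge0) => k l _.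
    have [->|_] := eqVneq k i; first by rewrite Ai' ltxx.
    by have [->|//] := eqVneq l i; rewrite Ai ltxx.
  move: pp; rewrite /bil mxE big1 ?ltxx // => j _.
  by rewrite (all_i j) xAi mul0r.
apply: (one_positive_eigenvalue_hyperplane symA pp).
apply: (perron_hyperplane symA irrA A_ge0 p_gt0) => [i|x];
  first by rewrite xA; case: (derG_pos i).
rewrite bilA; apply: ler_sum => i _; have [ppi onei] := derG_pos i.
rewrite -mulrA ler_pM2l // !xA ler_pdivlMr //.
by apply: reverse_cauchy_schwarz => //; exact: hess0_sym.
Qed.

(** * Reduction of condition (H) to Hessians along a positive vector *)

Theorem proposition2p4 (R : realType) (n d : nat) (f : {mpoly R[n]})
    (C : set 'rV[R]_n)
    (hd : (3 <= d)%N)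
    (hf : f \is d.-homog)
    (hC : open_convex_cone C)
    (heff : effective C)
    (h1 : forall x w : 'rV[R]_n, lineality_space C w ->
            f.@[(x + w) 0] = f.@[x 0])
    (h2 : forall vs : d.-tuple 'rV[R]_n, (forall v, v \in vs -> C v) ->
            0 < (dirderivs vs f)@_0%MM)
    (h3 : forall vs : (d - 2).-tuple 'rV[R]_n, (forall v, v \in vs -> C v) ->
            forall x : 'rV[R]_n,
              irreducible_mx (hessian (dirderivs vs f) x) /\
              offdiag_nonneg (hessian (dirderivs vs f) x))
    (h4 : forall i : 'I_n, lorentzian C f^`M(i)) :
  lorentzian C f.
Proof.
right; exists d; split=> //; case: d => [|[|[|e]]] // in hd hf h2 h3 *.
move=> vs hvs; split=> [|_]; first exact: h2.
(* Dropping v_1 and v_2 leaves the d - 2 directions v_3, ..., v_d; the origin is the point where the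
   Hessian is [hess0]. *)
have h3' := h3 [tuple of drop 2 vs] _ 0.
case/tupleP: vs => v1 vs in hvs h3' *; case/tupleP: vs => v2 vs in hvs h3' *.
case/tupleP: vs => v3 vs in hvs h3' *.
have Cws v : v \in vs -> C v by move=> vvs; apply: hvs; rewrite !inE vvs !orbT.
have C3 : C v3 by apply: hvs; rewrite !inE eqxx !orbT.
have := C3; rewrite {1}heff => -[p [Cp p_gt0] [w Lw v3E]].
rewrite /= in h3' *.
have Dw : dirderiv w f = 0 by apply: dirderiv_invariant => x; exact: h1.
set G := dirderivs vs f.
have D3 : dirderiv v3 G = dirderiv p G.
  by rewrite -v3E dirderivDl [dirderiv w _]dirderiv_dirderivs Dw dirderivs0
    addr0.
rewrite matrix_of_form_dirderiv -/G D3.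
have {h3'} [irrG nnegG] : irreducible_mx (hess0 (dirderiv p G)) /\
  offdiag_nonneg (hess0 (dirderiv p G)).
  rewrite -D3 -hessian0; apply: h3' => v; rewrite inE => /orP[/eqP -> //|];
    exact: Cws.
apply: hess0_dirderiv_one_positive_eigenvalue => // [|i].
  rewrite bil_hess0; apply: (h2 [tuple of p :: p :: p :: vs]) => v.
  by rewrite !inE => /or4P[/eqP ->|/eqP ->|/eqP ->|/Cws].
have GE : G^`M(i) = dirderivs vs f^`M(i).
  by rewrite -!dirderiv_delta dirderiv_dirderivs.
have [fi0|[d' [homfi fiP]]] := h4 i; first by left; rewrite GE fi0 dirderivs0.
(* The degree d' in [lorentzian] is existential; only for a nonzero derivative does homogeneity
   force d' = d - 1. *)
have [fi0|fi_neq0] := eqVneq f^`M(i) 0; first by left;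
  rewrite GE fi0 dirderivs0.
right; move: fiP; rewrite (dhomog_uniq fi_neq0 homfi (dhomog_mderiv i hf)) =>
  fiP.
(* Directions p, p followed by v_4, ..., v_d: condition (P) gives positivity of the form at p, and
   dropping the first two leaves the partial derivative of G for condition (H). *)
have [|pos /(_ isT)] := fiP [tuple of p :: p :: vs].
  by move=> v; rewrite !inE => /or3P[/eqP ->|/eqP ->|/Cws].
by rewrite /= drop0 matrix_of_form_dirderiv -GE bil_hess0 GE.
Qed.
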